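(* Let $H_1,H_2$ be Hopf algebras over $k$, let $\alpha,\beta\in \mathrm{Aut}_{Hopf}(H_1)$, $\gamma,\delta\in \mathrm{Aut}_{Hopf}(H_2)$, and assume that there exists a quadruple $(f_1,g_1,f_2,g_2)$ in involution corresponding to $(\alpha,\beta,\gamma,\delta)$. Then the categories ${}_{H_1}\mathcal{LR}_{H_2}(\alpha,\beta,\gamma,\delta)$ and ${}_{H_1}\mathcal{LR}_{H_2}$ are isomorphic. A pair of inverse functors $(F,G)$ is given as follows. If $M\in {}_{H_1}\mathcal{LR}_{H_2}(\alpha,\beta,\gamma,\delta)$, then $F(M)\in {}_{H_1}\mathcal{LR}_{H_2}$, where $F(M)=M$ as a vector space, with structures (left $H_1$-action $\rightarrow$, left $H_1$-coaction $m\mapsto m_{\langle -1\rangle}\otimes m_{\langle 0\rangle}$, right $H_2$-action $\leftarrow$, right $H_2$-coaction $m\mapsto m_{\{0\}}\otimes m_{\{1\}}$) \begin{align*} &h'\rightarrow m=f_1(\beta^{-1}S(h'_1))\,\beta^{-1}(h'_2)\triangleright m,\qquad m_{\langle -1\rangle}\otimes m_{\langle 0\rangle}=g_1^{-1}m_{(-1)}\otimes m_{(0)},\\ &m\leftarrow h''=m\triangleleft \gamma^{-1}(h''_1)\,f_2(\gamma^{-1}S(h''_2)),\qquad m_{\{0\}}\otimes m_{\{1\}}=m_{[0]}\otimes m_{[1]}g_2^{-1}. \end{align*} If $N\in {}_{H_1}\mathcal{LR}_{H_2}$ (with structures denoted $\rightarrow$, $n_{\langle -1\rangle}\otimes n_{\langle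 0\rangle}$, $\leftarrow$, $n_{\{0\}}\otimes n_{\{1\}}$), then $G(N)\in {}_{H_1}\mathcal{LR}_{H_2}(\alpha,\beta,\gamma,\delta)$, where $G(N)=N$ as a vector space, with structures \begin{align*} &h'\triangleright n=f_1(h'_1)\,\beta(h'_2)\rightarrow n,\qquad n_{(-1)}\otimes n_{(0)}=g_1n_{\langle -1\rangle}\otimes n_{\langle 0\rangle},\\ &n\triangleleft h''=n\leftarrow\gamma(h''_1)\,f_2(h''_2),\qquad n_{[0]}\otimes n_{[1]}=n_{\{0\}}\otimes n_{\{1\}}g_2. \end{align*} Both $F$ and $G$ act as identities on morphisms.
   Context: $k$ is a fixed field; all vector spaces and tensor products are over $k$. Hopf algebras are not assumed finite dimensional. Comultiplications are written $h\mapsto h_1\otimes h_2$ (Sweedler notation), and $S$ denotes the antipode of $H_1$ or $H_2$. $\mathrm{Aut}_{Hopf}(H)$ is the group of Hopf algebra automorphisms of $H$; juxtaposition of maps denotes composition. Category ${}_{H_1}\mathcal{LR}_{H_2}(\alpha,\beta,\gamma,\delta)$: an object is a vector space $M$ which is an $H_1$-$H_2$-bimodule (left $H_1$-action $h'\otimes m\mapsto h'\triangleright m$ and right $H_2$-action $m\otimes h''\mapsto m\triangleleft h''$, commuting) and an $H_1$-$H_2$-bicomodule (left $H_1$-coaction $m\mapsto m_{(-1)}\otimes m_{(0)}\in H_1\otimes M$ and right $H_2$-coaction $m\mapsto m_{[0]}\otimes m_{[1]}\in M\otimes H_2$, commuting), such that for all $h'\in H_1$, $h''\in H_2$, $m\in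 M$: \begin{align*} &\alpha(h'_1)m_{(-1)}\otimes h'_2\triangleright m_{(0)}=(h'_1\triangleright m)_{(-1)}\beta(h'_2)\otimes (h'_1\triangleright m)_{(0)},\\ &(h'\triangleright m)_{[0]}\otimes(h'\triangleright m)_{[1]}=h'\triangleright m_{[0]}\otimes m_{[1]},\\ &m_{[0]}\triangleleft h''_1\otimes m_{[1]}\delta(h''_2)=(m\triangleleft h''_2)_{[0]}\otimes \gamma(h''_1)(m\triangleleft h''_2)_{[1]},\\ &(m\triangleleft h'')_{(-1)}\otimes(m\triangleleft h'')_{(0)}=m_{(-1)}\otimes m_{(0)}\triangleleft h''. \end{align*} Morphisms are the $H_1$-$H_2$-bilinear and $H_1$-$H_2$-bicolinear maps. One writes ${}_{H_1}\mathcal{LR}_{H_2}={}_{H_1}\mathcal{LR}_{H_2}(id,id,id,id)$. Quadruple in involution: $(f_1,g_1,f_2,g_2)$ is a quadruple in involution corresponding to $(\alpha,\beta,\gamma,\delta)$ if $f_1:H_1\to k$, $f_2:H_2\to k$ are algebra maps and $g_1\in H_1$, $g_2\in H_2$ are group-like elements such that for all $h'\in H_1$, $h''\in H_2$, \begin{align*} &\alpha(h')=g_1f_1(h'_1)\beta(h'_2)f_1(S(h'_3))g_1^{-1},\\ &\delta(h'')=g_2^{-1}f_2(S(h''_1))\gamma(h''_2)f_2(h''_3)g_2. \end{align*} *)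

(* Defs.v *)
From HB Require Import structures.
From mathcomp Require Import all_boot all_algebra.
From mathcomp Require Import boolp.

Set Implicit Arguments.
Unset Strict Implicit.
Unset Printing Implicit Defensive.

Import GRing.Theory.
Local Open Scope ring_scope.
Local Open Scope quotient_scope.

Definition is_bilinear (k : fieldType) (A B V : lmodType k)
    (f : A -> B -> V) : Prop :=
  (forall b : B, linear (f^~ b)) /\ (forall a : A, linear (f a)).

(* A list [:: (a_1, b_1); ...; (a_n, b_n)] stands for the sum of the tensors  *)
(* a_i (x) b_i.  Two lists are identified when no bilinear map to any vector  *)
(* space separates them; tens_ind and tsum_unique below show that the         *)
(* quotient satisfies the universal property of the tensor product.           *)
Section TensorProduct.
Variables (k : fieldType) (A B : lmodType k).

Definition tens_eval (V : lmodType k) (f : A -> B -> V) (s : seq (A * B)) : V :=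
  \sum_(p <- s) f p.1 p.2.

Definition tens_rel (s t : seq (A * B)) : Prop :=
  forall (V : lmodType k) (f : A -> B -> V),
    is_bilinear f -> tens_eval f s = tens_eval f t.

Definition tens_relb : rel (seq (A * B)) := fun s t => `[< tens_rel s t >].

Lemma tens_relb_refl : reflexive tens_relb.
Proof. by move=> s; apply/asboolP. Qed.

Lemma tens_relb_sym : symmetric tens_relb.
Proof.
by move=> s t; apply/asboolP/asboolP => st V f bf; rewrite (st V f bf).
Qed.

Lemma tens_relb_trans : transitive tens_relb.
Proof.
move=> t s u /asboolP st /asboolP tu; apply/asboolP => V f bf.
by rewrite (st V f bf) (tu V f bf).
Qed.

Canonical tens_equiv :=
  EquivRel tens_relb tens_relb_refl tens_relb_sym tens_relb_trans.

Definition tensor := {eq_quot tens_equiv}.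
HB.instance Definition _ := Choice.on tensor.
HB.instance Definition _ := EqQuotient.on tensor.

Definition tens_class (s : seq (A * B)) : tensor := \pi_tensor s.

Definition tens (a : A) (b : B) : tensor := tens_class [:: (a, b)].

(* The linear map out of A (x) B induced by a bilinear map f.  It is total    *)
(* in f, but depends on the chosen representative when f is not bilinear.     *)
Definition tsum (V : lmodType k) (f : A -> B -> V) (t : tensor) : V :=
  tens_eval f (repr t).

Lemma tens_classK t : tens_class (repr t) = t.
Proof. exact: reprK. Qed.

Lemma tens_classP s t : tens_rel s t <-> tens_class s = tens_class t.
Proof.
split=> [st|/eqP]; first by apply/eqP; rewrite eqmodE; apply/asboolP.
by rewrite eqmodE => /asboolP.
Qed.

Lemma tsum_class (V : lmodType k) (f : A -> B -> V) s :
  is_bilinear f -> tsum f (tens_class s) = tens_eval f s.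
Proof. by move=> bf; apply: (tens_classP _ _).2 bf; rewrite tens_classK. Qed.

Lemma tens_sep (t u : tensor) :
  (forall (V : lmodType k) (f : A -> B -> V),
    is_bilinear f -> tsum f t = tsum f u) -> t = u.
Proof.
by move=> tu; rewrite -(tens_classK t) -(tens_classK u); apply/tens_classP.
Qed.

Definition tens_zero : tensor := tens_class [::].
Definition tens_add (t u : tensor) : tensor := tens_class (repr t ++ repr u).
Definition tens_scale (c : k) (t : tensor) : tensor :=
  tens_class [seq (c *: p.1, p.2) | p <- repr t].
Definition tens_opp (t : tensor) : tensor := tens_scale (-1) t.

Lemma tsum0 (V : lmodType k) (f : A -> B -> V) :
  is_bilinear f -> tsum f tens_zero = 0.
Proof. by move=> bf; rewrite tsum_class// /tens_eval big_nil. Qed.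

Lemma tsumD (V : lmodType k) (f : A -> B -> V) t u :
  is_bilinear f -> tsum f (tens_add t u) = tsum f t + tsum f u.
Proof. by move=> bf; rewrite tsum_class// /tens_eval big_cat. Qed.

Lemma bilinZl (V : lmodType k) (f : A -> B -> V) c a b :
  is_bilinear f -> f (c *: a) b = c *: f a b.
Proof.
move=> [bf _]; have f0 : f 0 b = 0.
  by have := bf b (-1) 0 0; rewrite scaler0 addr0 scaleN1r addNr.
by have := bf b c a 0; rewrite addr0 f0 addr0.
Qed.

Lemma tsumZ (V : lmodType k) (f : A -> B -> V) c t :
  is_bilinear f -> tsum f (tens_scale c t) = c *: tsum f t.
Proof.
move=> bf; rewrite tsum_class// /tens_eval big_map scaler_sumr.
by apply: eq_bigr => p _; rewrite bilinZl.
Qed.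

Definition tsumE := (tsum0, tsumD, tsumZ).

Lemma tens_addA : associative tens_add.
Proof. by move=> t u v; apply: tens_sep => V f bf; rewrite !tsumE// addrA. Qed.

Lemma tens_addC : commutative tens_add.
Proof. by move=> t u; apply: tens_sep => V f bf; rewrite !tsumE// addrC. Qed.

Lemma tens_add0 : left_id tens_zero tens_add.
Proof. by move=> t; apply: tens_sep => V f bf; rewrite !tsumE// add0r. Qed.

Lemma tens_addN : left_inverse tens_zero tens_opp tens_add.
Proof.
by move=> t; apply: tens_sep => V f bf; rewrite !tsumE// scaleN1r addNr.
Qed.

HB.instance Definition _ := GRing.isZmodule.Build tensor
  tens_addA tens_addC tens_add0 tens_addN.

Lemma tens_scaleA c d t : tens_scale c (tens_scale d t) = tens_scale (c * d) t.
Proof. by apply: tens_sep => V f bf; rewrite !tsumE// scalerA. Qed.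

Lemma tens_scale1 : left_id 1 tens_scale.
Proof. by move=> t; apply: tens_sep => V f bf; rewrite !tsumE// scale1r. Qed.

Lemma tens_scaleDr : right_distributive tens_scale +%R.
Proof.
by move=> c t u; apply: tens_sep => V f bf; rewrite !tsumE// scalerDr.
Qed.

Lemma tens_scaleDl t : {morph tens_scale^~ t : c d / c + d}.
Proof.
by move=> c d; apply: tens_sep => V f bf; rewrite !tsumE// scalerDl.
Qed.

HB.instance Definition _ := GRing.Zmodule_isLmodule.Build k tensor
  tens_scaleA tens_scale1 tens_scaleDr tens_scaleDl.

Lemma tsum_linear (V : lmodType k) (f : A -> B -> V) :
  is_bilinear f -> linear (tsum f).
Proof. by move=> bf c t u; rewrite [LHS]tsumD// [X in X + _]tsumZ. Qed.

Lemma tsum_tens (V : lmodType k) (f : A -> B -> V) a b :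
  is_bilinear f -> tsum f (tens a b) = f a b.
Proof. by move=> bf; rewrite tsum_class// /tens_eval big_seq1. Qed.

Lemma tens_bilinear : is_bilinear tens.
Proof.
split=> [b c x y|a c x y]; apply: tens_sep => V f bf.
  by rewrite tsum_linear// !tsum_tens// bf.1.
by rewrite tsum_linear// !tsum_tens// bf.2.
Qed.

Lemma tens_expand (t : tensor) : t = \sum_(p <- repr t) tens p.1 p.2.
Proof.
apply: tens_sep => V f bf; rewrite /tsum {1}/tens_eval.
rewrite -/(tsum f _); elim: (repr t) => [|p s IH].
  by rewrite !big_nil tsum0.
by rewrite !big_cons [RHS]tsumD// -IH tsum_tens.
Qed.

Lemma tens_ind (P : tensor -> Prop) :
  P 0 -> (forall a b t, P t -> P (tens a b + t)) -> forall t, P t.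
Proof.
move=> P0 PD t; rewrite (tens_expand t); elim: (repr t) => [|p s IH].
  by rewrite big_nil.
by rewrite big_cons; apply: PD.
Qed.

Lemma tsum_unique (V : lmodType k) (f : A -> B -> V)
    (g : {linear tensor -> V}) :
  is_bilinear f -> (forall a b, g (tens a b) = f a b) -> g =1 tsum f.
Proof.
move=> bf gf; elim/tens_ind => [|a b t IH]; first by rewrite linear0 [RHS]tsum0.
by rewrite linearD /= gf IH [RHS]tsumD// tsum_tens.
Qed.

Lemma eq_tsum (V : lmodType k) (f g : A -> B -> V) t :
  f =2 g -> tsum f t = tsum g t.
Proof. by move=> fg; apply: eq_bigr => p _. Qed.

End TensorProduct.

Lemma tsum_tsum (k : fieldType) (A B C D V : lmodType k)
    (g : C -> D -> V) (f : A -> B -> tensor C D) (t : tensor A B) :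
  is_bilinear g -> tsum g (tsum f t) = tsum (fun a b => tsum g (f a b)) t.
Proof.
move=> bg; rewrite /(tsum f) /(tsum _ t) /tens_eval; elim: (repr t) => [|p s IH].
  by rewrite !big_nil [LHS]tsum0.
by rewrite !big_cons [LHS]tsumD// IH.
Qed.

Notation "A ⊗ B" := (tensor A B)
  (at level 45, right associativity) : type_scope.
Notation "a ⊗ b" := (tens a b)
  (at level 45, right associativity) : ring_scope.
(* Sweedler notation: for t = \sum_i a_i ⊗ b_i and E bilinear in (a, b), the  *)
(* sum of the E(a_i, b_i).                                                    *)
Notation "\tsum_ ( a , b <- t ) E" := (tsum (fun a b => E) t)
  (at level 49, t at level 99, E at level 49, a name, b name,
   format "'[' \tsum_ ( a ,  b  <-  t ) '/  '  E ']'") : ring_scope.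

(* Threefold tensors are compared in H ⊗ (H ⊗ H), so that the associator of   *)
(* (H ⊗ H) ⊗ H is spelled out on the left of comulA.                          *)
Record hopfAlg (k : fieldType) := HopfAlg {
  hopf_alg :> algType k;
  comul : {linear hopf_alg -> (hopf_alg ⊗ hopf_alg)%type};
  counit : {lrmorphism hopf_alg -> k | *%R};
  antipode : {linear hopf_alg -> hopf_alg};
  comulA : forall h,
    \tsum_(h1, h2 <- comul h) \tsum_(h11, h12 <- comul h1) h11 ⊗ (h12 ⊗ h2)
    = \tsum_(h1, h2 <- comul h) h1 ⊗ comul h2;
  comul_counitl : forall h, \tsum_(h1, h2 <- comul h) counit h1 *: h2 = h;
  comul_counitr : forall h, \tsum_(h1, h2 <- comul h) counit h2 *: h1 = h;
  comul1 : comul 1 = 1 ⊗ 1;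
  comulM : forall x y,
    comul (x * y) =
      \tsum_(x1, x2 <- comul x) \tsum_(y1, y2 <- comul y) (x1 * y1) ⊗ (x2 * y2);
  antipodel : forall h,
    \tsum_(h1, h2 <- comul h) antipode h1 * h2 = (counit h)%:A;
  antipoder : forall h,
    \tsum_(h1, h2 <- comul h) h1 * antipode h2 = (counit h)%:A
}.

Record hopfAut (k : fieldType) (H : hopfAlg k) := HopfAut {
  aut_map :> {lrmorphism H -> H};
  aut_inv : H -> H;
  aut_mapK : cancel aut_map aut_inv;
  aut_invK : cancel aut_inv aut_map;
  aut_comul : forall h,
    comul H (aut_map h) = \tsum_(h1, h2 <- comul H h) aut_map h1 ⊗ aut_map h2;
  aut_counit : forall h, counit H (aut_map h) = counit H h
}.

Section IdentityAut.
Variables (k : fieldType) (H : hopfAlg k).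

Fact hopf_id_comul (h : H) :
  comul H (idfun h) = \tsum_(h1, h2 <- comul H h) idfun h1 ⊗ idfun h2.
Proof. exact: (tsum_unique (g := idfun) (@tens_bilinear _ _ _)). Qed.

Definition hopf_id : hopfAut H :=
  HopfAut (aut_map := idfun) (aut_inv := idfun)
    (frefl _) (frefl _) hopf_id_comul (frefl _).

End IdentityAut.

Record groupLike (k : fieldType) (H : hopfAlg k) := GroupLike {
  gl_val : H;
  gl_comul : comul H gl_val = gl_val ⊗ gl_val;
  gl_counit : counit H gl_val = 1
}.

(* The inverse of a group-like element, see gl_mulV and gl_mulVl.             *)
Definition gl_inv (k : fieldType) (H : hopfAlg k) (g : groupLike H) : H :=
  antipode H (gl_val g).

Section GroupLikeInverse.
Variables (k : fieldType) (H : hopfAlg k) (g : groupLike H).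

Lemma gl_mulV : gl_val g * gl_inv g = 1.
Proof.
have := antipoder (gl_val g); rewrite gl_comul gl_counit scale1r tsum_tens//.
split=> [b|a] c x y /=; first by rewrite mulrDl scalerAl.
by rewrite linearP mulrDr -scalerAr.
Qed.

Lemma gl_mulVl : gl_inv g * gl_val g = 1.
Proof.
have := antipodel (gl_val g); rewrite gl_comul gl_counit scale1r tsum_tens//.
split=> [b|a] c x y /=; last by rewrite mulrDr scalerAr.
by rewrite linearP mulrDl -scalerAl.
Qed.

End GroupLikeInverse.

Section Modules.
Variables (k : fieldType) (H : hopfAlg k) (M : lmodType k).

Definition is_left_module (act : H -> M -> M) : Prop :=
  [/\ is_bilinear act,
      forall m, act 1 m = m
    & forall x y m, act (x * y) m = act x (act y m)].

Definition is_right_module (act : M -> H -> M) : Prop :=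
  [/\ is_bilinear act,
      forall m, act m 1 = m
    & forall m x y, act m (x * y) = act (act m x) y].

Definition is_left_comodule (coact : M -> H ⊗ M) : Prop :=
  [/\ linear coact,
      forall m,
        \tsum_(h, m0 <- coact m) \tsum_(h1, h2 <- comul H h) h1 ⊗ (h2 ⊗ m0)
        = \tsum_(h, m0 <- coact m) h ⊗ coact m0
    & forall m, \tsum_(h, m0 <- coact m) counit H h *: m0 = m].

Definition is_right_comodule (coact : M -> M ⊗ H) : Prop :=
  [/\ linear coact,
      forall m,
        \tsum_(m0, h <- coact m) \tsum_(m00, h' <- coact m0) m00 ⊗ (h' ⊗ h)
        = \tsum_(m0, h <- coact m) m0 ⊗ comul H h
    & forall m, \tsum_(m0, h <- coact m) counit H h *: m0 = m].

End Modules.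

Record category := Category {
  ob :> Type;
  hom : ob -> ob -> Type;
  idm : forall x, hom x x;
  comp : forall x y z, hom y z -> hom x y -> hom x z;
  comp_idl : forall x y (f : hom x y), comp (idm y) f = f;
  comp_idr : forall x y (f : hom x y), comp f (idm x) = f;
  compA : forall x y z t (h : hom z t) (g : hom y z) (f : hom x y),
    comp h (comp g f) = comp (comp h g) f
}.

Record functor (C D : category) := Functor {
  fob :> C -> D;
  fmap : forall x y : C, hom x y -> hom (fob x) (fob y);
  fmap_id : forall x, fmap (idm x) = idm (fob x);
  fmap_comp : forall (x y z : C) (g : hom y z) (f : hom x y),
    fmap (comp g f) = comp (fmap g) (fmap f)
}.

Definition functor_id (C : category) : functor C C :=
  @Functor C C id (fun _ _ => id) (fun _ => erefl) (fun _ _ _ _ _ => erefl).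

Section FunctorComposition.
Variables (C D E : category) (G : functor D E) (F : functor C D).

Let cmap (x y : C) (f : hom x y) : hom (G (F x)) (G (F y)) := fmap G (fmap F f).

Fact functor_comp_id (x : C) : cmap (idm x) = idm (G (F x)).
Proof. by rewrite /cmap !fmap_id. Qed.

Fact functor_comp_comp (x y z : C) (g : hom y z) (f : hom x y) :
  cmap (comp g f) = comp (cmap g) (cmap f).
Proof. by rewrite /cmap !fmap_comp. Qed.

Definition functor_comp : functor C E :=
  @Functor C E (fun x => G (F x)) cmap functor_comp_id functor_comp_comp.

End FunctorComposition.

(* Strict (not up to natural isomorphism) mutually inverse functors.          *)
Definition inverse_functors (C D : category)
    (F : functor C D) (G : functor D C) : Prop :=
  functor_comp G F = functor_id C /\ functor_comp F G = functor_id D.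

Definition isomorphic_categories (C D : category) : Prop :=
  exists (F : functor C D) (G : functor D C), inverse_functors F G.

Record LRstr (k : fieldType) (H1 H2 : hopfAlg k) (M : lmodType k) := LRStr {
  lact : H1 -> M -> M;
  lcoact : M -> H1 ⊗ M;
  ract : M -> H2 -> M;
  rcoact : M -> M ⊗ H2
}.

Section LR.
Variables (k : fieldType) (H1 H2 : hopfAlg k).

Record is_LR (al be : hopfAut H1) (ga de : hopfAut H2) (M : lmodType k)
    (s : LRstr H1 H2 M) : Prop := IsLR {
  LR_lmod : is_left_module (lact s);
  LR_rmod : is_right_module (ract s);
  LR_bimod : forall h' m h'',
    ract s (lact s h' m) h'' = lact s h' (ract s m h'');
  LR_lcomod : is_left_comodule (lcoact s);
  LR_rcomod : is_right_comodule (rcoact s);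
  LR_bicomod : forall m,
    \tsum_(h', m0 <- lcoact s m) h' ⊗ rcoact s m0
    = \tsum_(m0, h'' <- rcoact s m)
        \tsum_(h', m00 <- lcoact s m0) h' ⊗ (m00 ⊗ h'');
  LR_left_left : forall h' m,
    \tsum_(h1, h2 <- comul H1 h') \tsum_(x, m0 <- lcoact s m)
      (al h1 * x) ⊗ lact s h2 m0
    = \tsum_(h1, h2 <- comul H1 h') \tsum_(x, m0 <- lcoact s (lact s h1 m))
      (x * be h2) ⊗ m0;
  LR_left_right : forall h' m,
    rcoact s (lact s h' m) = \tsum_(m0, x <- rcoact s m) lact s h' m0 ⊗ x;
  LR_right_right : forall m h'',
    \tsum_(h1, h2 <- comul H2 h'') \tsum_(m0, x <- rcoact s m)
      ract s m0 h1 ⊗ (x * de h2)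
    = \tsum_(h1, h2 <- comul H2 h'') \tsum_(m0, x <- rcoact s (ract s m h2))
      m0 ⊗ (ga h1 * x);
  LR_right_left : forall m h'',
    lcoact s (ract s m h'') = \tsum_(x, m0 <- lcoact s m) x ⊗ ract s m0 h''
}.

Record is_LR_mor (M N : lmodType k) (s : LRstr H1 H2 M) (t : LRstr H1 H2 N)
    (f : M -> N) : Prop := IsLRMor {
  LRmor_linear : linear f;
  LRmor_lact : forall h m, f (lact s h m) = lact t h (f m);
  LRmor_ract : forall m h, f (ract s m h) = ract t (f m) h;
  LRmor_lcoact : forall m,
    lcoact t (f m) = \tsum_(x, m0 <- lcoact s m) x ⊗ f m0;
  LRmor_rcoact : forall m,
    rcoact t (f m) = \tsum_(m0, x <- rcoact s m) f m0 ⊗ x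
}.

Record LRob (al be : hopfAut H1) (ga de : hopfAut H2) := LROb {
  LR_space :> lmodType k;
  LR_str : LRstr H1 H2 LR_space;
  LR_axioms : is_LR al be ga de LR_str
}.

Section Category.
Variables (al be : hopfAut H1) (ga de : hopfAut H2).
Implicit Types M N P : LRob al be ga de.

Record LRhom M N := LRHom {
  LR_fun :> M -> N;
  LR_fun_mor : is_LR_mor (LR_str M) (LR_str N) LR_fun
}.

Lemma LRhom_eq M N (f g : LRhom M N) : f =1 g -> f = g.
Proof.
case: f g => [f fP] [g gP] /= /funext fg; case: _ / fg in gP *.
by congr LRHom; apply: Prop_irrelevance.
Qed.

Fact LR_id_mor M : is_LR_mor (LR_str M) (LR_str M) id.
Proof.
by split=> // m; apply: (tsum_unique (g := idfun) (@tens_bilinear _ _ _)).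
Qed.

Fact LR_comp_mor M N P (g : LRhom N P) (f : LRhom M N) :
  is_LR_mor (LR_str M) (LR_str P) (g \o f).
Proof.
case: f g => f [fl fla fra flc frc] [g [gl gla gra glc grc]].
split=> [c u v|h m|m h|m|m] /=.
- by rewrite fl gl.
- by rewrite fla gla.
- by rewrite fra gra.
- have bg : is_bilinear (fun (x : H1) n => x ⊗ g n).
    split=> [b|a] c u v /=; first exact: (tens_bilinear _ _).1.
    by rewrite gl; apply: (tens_bilinear _ _).2.
  by rewrite glc flc tsum_tsum//; apply: eq_tsum => x n; rewrite tsum_tens.
- have bg : is_bilinear (fun n (x : H2) => g n ⊗ x).
    split=> [b|a] c u v /=; last exact: (tens_bilinear _ _).2.
    by rewrite gl; apply: (tens_bilinear _ _).1.
  by rewrite grc frc tsum_tsum//; apply: eq_tsum => x n; rewrite tsum_tens.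
Qed.

Definition LR_idm M : LRhom M M := LRHom (LR_id_mor M).

Definition LR_comp M N P (g : LRhom N P) (f : LRhom M N) : LRhom M P :=
  LRHom (LR_comp_mor g f).

Fact LR_comp_idl M N (f : LRhom M N) : LR_comp (LR_idm N) f = f.
Proof. exact: LRhom_eq. Qed.

Fact LR_comp_idr M N (f : LRhom M N) : LR_comp f (LR_idm M) = f.
Proof. exact: LRhom_eq. Qed.

Fact LR_compA M N P Q (h : LRhom P Q) (g : LRhom N P) (f : LRhom M N) :
  LR_comp h (LR_comp g f) = LR_comp (LR_comp h g) f.
Proof. exact: LRhom_eq. Qed.

Definition LR_category : category :=
  Category LR_comp_idl LR_comp_idr LR_compA.

End Category.

Definition LR_category_id : category :=
  LR_category (hopf_id H1) (hopf_id H1) (hopf_id H2) (hopf_id H2).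

(* Functors that leave the underlying vector spaces alone, replace the        *)
(* structure maps on each of them by Phi, and are the identity on morphisms.  *)
Section ChangeOfStructure.
Variables (al be al' be' : hopfAut H1) (ga de ga' de' : hopfAut H2).
Variable Phi : forall M : lmodType k, LRstr H1 H2 M -> LRstr H1 H2 M.

Definition preserves_LR : Prop :=
  forall (M : lmodType k) (s : LRstr H1 H2 M),
    is_LR al be ga de s -> is_LR al' be' ga' de' (Phi s).

Definition preserves_LR_mor : Prop :=
  forall (M N : lmodType k) (s : LRstr H1 H2 M) (t : LRstr H1 H2 N)
      (f : M -> N),
    is_LR al be ga de s -> is_LR al be ga de t ->
    is_LR_mor s t f -> is_LR_mor (Phi s) (Phi t) f.

Hypotheses (PhiO : preserves_LR) (PhiM : preserves_LR_mor).

Definition LR_change_ob (M : LR_category al be ga de) :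
    LR_category al' be' ga' de' :=
  LROb (PhiO (LR_axioms M)).

Definition LR_change_mor (M N : LR_category al be ga de) (f : hom M N) :
    hom (LR_change_ob M) (LR_change_ob N) :=
  @LRHom _ _ _ _ (LR_change_ob M) (LR_change_ob N) (LR_fun f)
    (PhiM (LR_axioms M) (LR_axioms N) (LR_fun_mor f)).

Fact LR_change_id (M : LR_category al be ga de) :
  LR_change_mor (idm M) = idm (LR_change_ob M).
Proof. exact: LRhom_eq. Qed.

Fact LR_change_comp (M N P : LR_category al be ga de)
    (g : hom N P) (f : hom M N) :
  LR_change_mor (comp g f) = comp (LR_change_mor g) (LR_change_mor f).
Proof. exact: LRhom_eq. Qed.

Definition LR_change :
    functor (LR_category al be ga de) (LR_category al' be' ga' de') :=
  Functor LR_change_id LR_change_comp.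

End ChangeOfStructure.

Section Involution.
Variables (al be : hopfAut H1) (ga de : hopfAut H2).
Variables (f1 : {lrmorphism H1 -> k | *%R}) (g1 : groupLike H1).
Variables (f2 : {lrmorphism H2 -> k | *%R}) (g2 : groupLike H2).

Definition quadruple_in_involution : Prop :=
  (forall h : H1,
     al h = \tsum_(h1, t <- comul H1 h) \tsum_(h2, h3 <- comul H1 t)
       (f1 h1 * f1 (antipode H1 h3)) *: (gl_val g1 * be h2 * gl_inv g1)) /\
  (forall h : H2,
     de h = \tsum_(h1, t <- comul H2 h) \tsum_(h2, h3 <- comul H2 t)
       (f2 (antipode H2 h1) * f2 h3) *: (gl_inv g2 * ga h2 * gl_val g2)).

Definition F_str (M : lmodType k) (s : LRstr H1 H2 M) : LRstr H1 H2 M :=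
  {| lact := fun h m => \tsum_(h1, h2 <- comul H1 h)
       f1 (aut_inv be (antipode H1 h1)) *: lact s (aut_inv be h2) m;
     lcoact := fun m => \tsum_(x, m0 <- lcoact s m) (gl_inv g1 * x) ⊗ m0;
     ract := fun m h => \tsum_(h1, h2 <- comul H2 h)
       f2 (aut_inv ga (antipode H2 h2)) *: ract s m (aut_inv ga h1);
     rcoact := fun m => \tsum_(m0, x <- rcoact s m) m0 ⊗ (x * gl_inv g2) |}.

Definition G_str (N : lmodType k) (s : LRstr H1 H2 N) : LRstr H1 H2 N :=
  {| lact := fun h n => \tsum_(h1, h2 <- comul H1 h)
       f1 h1 *: lact s (be h2) n;
     lcoact := fun n => \tsum_(x, n0 <- lcoact s n) (gl_val g1 * x) ⊗ n0;
     ract := fun n h => \tsum_(h1, h2 <- comul H2 h)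
       f2 h2 *: ract s n (ga h1);
     rcoact := fun n => \tsum_(n0, x <- rcoact s n) n0 ⊗ (x * gl_val g2) |}.

End Involution.
End LR.

(* Main.v *)
Require Import Defs.
From mathcomp Require Import all_boot all_algebra.
From mathcomp Require Import boolp.
From HB Require Import structures.

(* The action of G(N) is that of N precomposed with th(h) = f1(h1) be(h2), and
   its coaction is that of N multiplied by g1; similarly on the right, with
   ph(h) = ga(h1) f2(h2).  Since f1 is a character, th is a bijective algebra
   map, which satisfies Delta(th(h)) = th(h1) ⊗ be(h2); and cancelling f1 against
   f1 S turns the involution condition into al(h1) f1(h2) = g1 th(h) g1^-1.
   Together these two identities say exactly that precomposition by th and
   multiplication by g1 carry the compatibility condition for (id, id) to the
   one for (al, be).  The two twisting conditions are inherited by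
   (th^-1, g1^-1), which defines F, so that F is the strict inverse of G. *)

Set Implicit Arguments.
Unset Strict Implicit.
Unset Printing Implicit Defensive.
Import GRing.Theory.
Local Open Scope ring_scope.

(** * Linearity of Sweedler expressions *)

Section Linearity.
Variable k : fieldType.
Implicit Types U V W A B : lmodType k.

Lemma lin_id U : linear (fun x : U => x). Proof. by []. Qed.

Lemma lin_comp U V W (g : V -> W) (f : U -> V) :
  linear g -> linear f -> linear (fun x => g (f x)).
Proof. by move=> gl fl c x y; rewrite fl gl. Qed.

Lemma lin_map U V (f : {linear U -> V}) : linear f. Proof. exact: linearP. Qed.

Lemma lin_scalar U V (g : {scalar V}) (f : U -> V) :
  linear f -> linear ((fun x => g (f x)) : U -> k^o).
Proof. by move=> fl c x y; rewrite fl linearP. Qed.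

Lemma lin_scalel U V (c : U -> k) (v : V) :
  linear (c : U -> k^o) -> linear (fun x => c x *: v).
Proof. by move=> cl a x y; rewrite cl scalerDl scalerA. Qed.

Lemma lin_scaler U V (c : k) (f : U -> V) :
  linear f -> linear (fun x => c *: f x).
Proof. by move=> fl a x y; rewrite fl scalerDr !scalerA mulrC. Qed.

Lemma lin_mull U (R : algType k) (f : U -> R) (r : R) :
  linear f -> linear (fun x => f x * r).
Proof. by move=> fl c x y; rewrite fl mulrDl scalerAl. Qed.

Lemma lin_mulr U (R : algType k) (f : U -> R) (r : R) :
  linear f -> linear (fun x => r * f x).
Proof. by move=> fl c x y; rewrite fl mulrDr scalerAr. Qed.

Lemma lin_bil U A B V (g : A -> B -> V) (f : U -> A) (b : B) :
  is_bilinear g -> linear f -> linear (fun x => g (f x) b).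
Proof. by move=> [gl _] fl c x y; rewrite fl gl. Qed.

Lemma lin_bir U A B V (g : A -> B -> V) (a : A) (f : U -> B) :
  is_bilinear g -> linear f -> linear (fun x => g a (f x)).
Proof. by move=> [_ gr] fl c x y; rewrite fl gr. Qed.

Lemma lin_tsum U A B V (f : A -> B -> V) (t : U -> (A ⊗ B)%type) :
  is_bilinear f -> linear t -> linear (fun x => tsum f (t x)).
Proof. by move=> bf tl; apply: lin_comp => //; apply: tsum_linear. Qed.

(** [tsum] sums over a representative of [t] chosen independently of the summand, so it inherits
    linearity in a parameter from each term. *)
Lemma lin_tsum_fun U A B V (f : U -> A -> B -> V) (t : (A ⊗ B)%type) :
  (forall a b, linear (fun x => f x a b)) -> linear (fun x => tsum (f x) t).
Proof.
move=> fl c x y; rewrite /tsum /tens_eval scaler_sumr -big_split.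
by apply: eq_bigr => p _; rewrite fl.
Qed.

End Linearity.

(** Peels off the outermost operation of the expression. Hypotheses of the context are tried with
    backtracking, since several may fit; bundled linear maps come last, their pattern being the most
    permissive. *)
Ltac bilin := cbv beta; lazymatch goal with
  | |- is_bilinear _ => first [assumption | exact: tens_bilinear
        | split=> [?|?]; bilin]
  | |- forall _, is_bilinear _ => move=> ?; bilin
  | |- forall _ _, GRing.linear_for _ _ => move=> ? ?; bilin
  | |- GRing.linear_for _ _ => first [assumption | exact: lin_id
     | exact: lin_map
     | apply: lin_scalar; bilin
     | apply: lin_scalel; bilin | apply: lin_scaler; bilin
     | apply: lin_mull; bilin | apply: lin_mulr; bilin
     | apply: lin_tsum; bilin
     | apply: lin_tsum_fun; bilin
     | apply: (lin_bil _ (@tens_bilinear _ _ _)); bilin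
     | apply: (lin_bir _ (@tens_bilinear _ _ _)); bilin
     | multimatch goal with
       | B : is_bilinear _ |- _ =>
           first [apply: (lin_bil _ B); bilin | apply: (lin_bir _ B); bilin]
       | L : GRing.linear_for _ _ |- _ => apply: (lin_comp L); bilin
       end
     | lazymatch goal with
       | |- GRing.linear_for _ (fun x => ?g (@?f x)) =>
         apply: (@lin_comp _ _ _ _ g f); [exact: lin_map | bilin]
       end ]
  end.

(** * Rewriting sums over tensors *)

Section Sums.
Variable k : fieldType.
Implicit Types A B C D V W : lmodType k.

Lemma tsum_id A B (t : (A ⊗ B)%type) : \tsum_(a, b <- t) a ⊗ b = t.
Proof. by rewrite [RHS]tens_expand. Qed.

Lemma linear_tsum A B V W (L : V -> W) (f : A -> B -> V) (t : (A ⊗ B)%type) :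
  linear L -> L (tsum f t) = \tsum_(a, b <- t) L (f a b).
Proof.
move=> Ll; pose L' : {linear V -> W} :=
  HB.pack L (GRing.isLinear.Build _ _ _ _ L Ll).
exact: (linear_sum L').
Qed.

Lemma bilinZr A B V (f : A -> B -> V) c a b :
  is_bilinear f -> f a (c *: b) = c *: f a b.
Proof.
move=> [_ bf]; have f0 : f a 0 = 0.
  by have := bf a (-1) 0 0; rewrite scaler0 addr0 scaleN1r addNr.
by have := bf a c b 0; rewrite addr0 f0 addr0.
Qed.

Lemma tsum_map A B C D V (E : C -> D -> V) (u : A -> B -> C) (v : A -> B -> D)
    (t : (A ⊗ B)%type) :
  is_bilinear E ->
  tsum E (\tsum_(a, b <- t) u a b ⊗ v a b)
  = \tsum_(a, b <- t) E (u a b) (v a b).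
Proof.
by move=> bE; rewrite tsum_tsum//; apply: eq_tsum => a b; rewrite tsum_tens.
Qed.

(** The form in which Sweedler identities are applied below: an equality of tensors is pushed
    through the linear map induced by [E]. *)
Lemma tsum_transfer A B A' B' C D V (E : C -> D -> V)
    (u : A -> B -> C) (v : A -> B -> D) (t : (A ⊗ B)%type)
    (u' : A' -> B' -> C) (v' : A' -> B' -> D) (t' : (A' ⊗ B')%type) :
  is_bilinear E ->
  \tsum_(a, b <- t) u a b ⊗ v a b = \tsum_(a, b <- t') u' a b ⊗ v' a b ->
  \tsum_(a, b <- t) E (u a b) (v a b)
  = \tsum_(a, b <- t') E (u' a b) (v' a b).
Proof. by move=> bE tt; rewrite -(tsum_map u v t bE) tt tsum_map. Qed.

End Sums.

(** * Coassociativity, hit actions and convolution inverses *)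

Section Sweedler.
Variables (k : fieldType) (H : hopfAlg k).

(** The two hypotheses together say that [E] is trilinear, so it induces a linear map on
    [H ⊗ (H ⊗ H)], which is applied to both sides of [comulA]. *)
Lemma tsum_comulA (V : lmodType k) (E : H -> H -> H -> V) (h : H) :
  (forall c, is_bilinear (fun a b => E a b c)) ->
  (forall a, is_bilinear (E a)) ->
  \tsum_(h1, h2 <- comul H h) \tsum_(h11, h12 <- comul H h1) E h11 h12 h2
  = \tsum_(h1, h2 <- comul H h) \tsum_(h21, h22 <- comul H h2) E h1 h21 h22.
Proof.
move=> El Er.
have bT : is_bilinear (fun a => tsum (E a)).
  split=> [t|a]; last exact: tsum_linear.
  by apply: lin_tsum_fun => b c x y z; rewrite (El _).1.
have /(congr1 (tsum (fun a => tsum (E a)))) := comulA h.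
rewrite !tsum_tsum//.
under eq_tsum => a b.
  rewrite tsum_map//; under eq_tsum => c d do rewrite tsum_tens//.
  over.
by move=> ->; apply: eq_tsum => a b; rewrite tsum_tens.
Qed.

Implicit Types f phi psi : {scalar H}.

(** With [twr], the two hit actions of the dual algebra on [H]: [twl f h] is h ↼ f, a right action,
    and [twr f h] is f ⇀ h, a left one. *)
Definition twl (f : H -> k) (h : H) : H :=
  \tsum_(h1, h2 <- comul H h) f h1 *: h2.
Definition twr (f : H -> k) (h : H) : H :=
  \tsum_(h1, h2 <- comul H h) f h2 *: h1.

Fact twl_linear f : linear (twl f). Proof. by rewrite /twl; bilin. Qed.
Fact twr_linear f : linear (twr f). Proof. by rewrite /twr; bilin. Qed.

HB.instance Definition _ f :=
  GRing.isLinear.Build k H H *:%R (twl f) (twl_linear f).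
HB.instance Definition _ f :=
  GRing.isLinear.Build k H H *:%R (twr f) (twr_linear f).

(** Both sides are f(h1) h2 ⊗ h3: by coassociativity, evaluating the first leg affects only the left
    factor of the coproduct. *)
Lemma comul_twl f h :
  comul H (twl f h) = \tsum_(h1, h2 <- comul H h) twl f h1 ⊗ h2.
Proof.
rewrite (linear_tsum (L := comul H)); last bilin.
transitivity (\tsum_(h1, h2 <- comul H h) \tsum_(h21, h22 <- comul H h2)
    f h1 *: (h21 ⊗ h22)).
  apply: eq_tsum => a b; rewrite linearZ /= -[in LHS](tsum_id (comul H b)).
  by apply: (linear_tsum (L := fun x => f a *: x)); bilin.
rewrite -tsum_comulA => *; try bilin.
apply: eq_tsum => a b; rewrite /twl (linear_tsum (L := fun x => x ⊗ b)).
  by apply: eq_tsum => c d; rewrite bilinZl//; apply: tens_bilinear.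
bilin.
Qed.

Lemma comul_twr f h :
  comul H (twr f h) = \tsum_(h1, h2 <- comul H h) h1 ⊗ twr f h2.
Proof.
rewrite (linear_tsum (L := comul H)); last bilin.
transitivity (\tsum_(h1, h2 <- comul H h) \tsum_(h11, h12 <- comul H h1)
    f h2 *: (h11 ⊗ h12)).
  apply: eq_tsum => a b; rewrite linearZ /= -[in LHS](tsum_id (comul H a)).
  by apply: (linear_tsum (L := fun x => f b *: x)); bilin.
rewrite tsum_comulA => *; try bilin.
apply: eq_tsum => a b; rewrite /twr (linear_tsum (L := tens a)); last bilin.
by apply: eq_tsum => c d; rewrite bilinZr//; apply: tens_bilinear.
Qed.

(** Both sides are f(h2) h1 ⊗ h3: the evaluated middle leg can be attached to either neighbour. *)
Lemma tsum_twl_twr f h :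
  \tsum_(h1, h2 <- comul H h) h1 ⊗ twl f h2
  = \tsum_(h1, h2 <- comul H h) twr f h1 ⊗ h2.
Proof.
transitivity (\tsum_(h1, h2 <- comul H h) \tsum_(h21, h22 <- comul H h2)
    (f h21 *: h1) ⊗ h22).
  apply: eq_tsum => a b; rewrite (linear_tsum (L := tens a)); last bilin.
  by apply: eq_tsum => c d; rewrite bilinZl ?bilinZr//; apply: tens_bilinear.
rewrite -tsum_comulA => *; try bilin.
apply: eq_tsum => a b; rewrite (linear_tsum (L := fun x => x ⊗ b))//; bilin.
Qed.

Lemma twl_twr f phi h : twl f (twr phi h) = twr phi (twl f h).
Proof.
rewrite /(twl f) comul_twr tsum_map; last bilin.
rewrite [RHS](linear_tsum (L := twr phi)); last bilin.
by apply: eq_tsum => a b; rewrite linearZ.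
Qed.

Definition conv_unit (phi psi : H -> k) : Prop :=
  forall h, tsum (fun h1 h2 => phi h1 * psi h2 : k^o) (comul H h) = counit H h.

(** The composite is phi(h1) psi(h2) h3, the hit action of the convolution product of [phi] and
    [psi], which is the counit. *)
Lemma conv_unit_twl phi psi h : conv_unit phi psi -> twl psi (twl phi h) = h.
Proof.
move=> e; rewrite /(twl psi) comul_twl tsum_map; last bilin.
transitivity (\tsum_(h1, h2 <- comul H h) \tsum_(h11, h12 <- comul H h1)
    (phi h11 * psi h12) *: h2); last first.
  rewrite -[RHS]comul_counitl; apply: eq_tsum => a b.
  rewrite -e (linear_tsum (L := fun c : k^o => (c : k) *: b))//.
  by move=> c x y; rewrite scalerDl scalerA.
apply: eq_tsum => a b.
rewrite (linear_tsum (L := fun x => psi x *: b)); last bilin.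
by apply: eq_tsum => c d; rewrite linearZ /=.
Qed.

(** Here the composite is h1 psi(h2) phi(h3), so the convolution product is taken in the other order
    than for [twl]. *)
Lemma conv_unit_twr phi psi h : conv_unit psi phi -> twr psi (twr phi h) = h.
Proof.
move=> e; rewrite /(twr psi) comul_twr tsum_map; last bilin.
transitivity (\tsum_(h1, h2 <- comul H h) \tsum_(h21, h22 <- comul H h2)
    (psi h21 * phi h22) *: h1); last first.
  rewrite -[RHS]comul_counitr; apply: eq_tsum => a b.
  rewrite -e (linear_tsum (L := fun c : k^o => (c : k) *: a))//.
  by move=> c x y; rewrite scalerDl scalerA.
apply: eq_tsum => a b.
rewrite (linear_tsum (L := fun x => psi x *: a)); last bilin.
by apply: eq_tsum => c d; rewrite linearZ /= mulrC.
Qed.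

Section Character.
Variable f : {lrmorphism H -> k | *%R}.

Lemma conv_unit_antipoder : conv_unit f (f \o antipode H).
Proof.
move=> h; have <-: f (counit H h)%:A = counit H h.
  by rewrite linearZ /= rmorph1 mulr1.
rewrite -antipoder.
rewrite (linear_tsum (L := f : H -> k^o) _ (comul H h)); last exact: lin_scalar.
by apply: eq_tsum => a b; rewrite rmorphM.
Qed.

Lemma conv_unit_antipodel : conv_unit (f \o antipode H) f.
Proof.
move=> h; have <-: f (counit H h)%:A = counit H h.
  by rewrite linearZ /= rmorph1 mulr1.
rewrite -antipodel.
rewrite (linear_tsum (L := f : H -> k^o) _ (comul H h)); last exact: lin_scalar.
by apply: eq_tsum => a b; rewrite rmorphM.
Qed.

Lemma twl1 : twl f 1 = 1.
Proof. by rewrite /twl comul1 tsum_tens ?rmorph1 ?scale1r//; bilin. Qed.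

Lemma twr1 : twr f 1 = 1.
Proof. by rewrite /twr comul1 tsum_tens ?rmorph1 ?scale1r//; bilin. Qed.

(** For a character, [twl f] is the composite of the algebra maps Delta and f ⊗ id. *)
Lemma twlM : {morph twl f : x y / x * y}.
Proof.
move=> x y; rewrite {1}/twl comulM tsum_tsum; last bilin.
rewrite {2}/twl [RHS](linear_tsum (L := fun u => u * twl f y)); last bilin.
apply: eq_tsum => a b; rewrite tsum_map; last bilin.
rewrite /twl (linear_tsum (L := fun u => (f a *: b) * u)); last bilin.
by apply: eq_tsum => c d; rewrite rmorphM -scalerAl -scalerAr scalerA.
Qed.

Lemma twrM : {morph twr f : x y / x * y}.
Proof.
move=> x y; rewrite {1}/twr comulM tsum_tsum; last bilin.
rewrite {2}/twr [RHS](linear_tsum (L := fun u => u * twr f y)); last bilin.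
apply: eq_tsum => a b; rewrite tsum_map; last bilin.
rewrite /twr (linear_tsum (L := fun u => (f b *: a) * u)); last bilin.
by apply: eq_tsum => c d; rewrite rmorphM -scalerAl -scalerAr scalerA.
Qed.

End Character.

End Sweedler.

(** * Inverses of group-like elements and of automorphisms *)

Section GroupLike.
Variables (k : fieldType) (H : hopfAlg k) (g : groupLike H).

Fact gl_inv_comul : comul H (gl_inv g) = gl_inv g ⊗ gl_inv g.
Proof.
(* Multiplying both legs by g^-1 on the left turns Delta(g) Delta(g^-1) = 1 ⊗ 1 into the claim. *)
pose E (a b : H) := (gl_inv g * a) ⊗ (gl_inv g * b).
have bE : is_bilinear E by rewrite /E; bilin.
have := congr1 (tsum E) (comul1 H).
rewrite -{1}(gl_mulV g) comulM gl_comul tsum_tens; last by bilin.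
rewrite tsum_map// tsum_tens// /E !mulr1 => <-.
rewrite -[LHS]tsum_id; apply: eq_tsum => a b.
by rewrite !mulrA gl_mulVl !mul1r.
Qed.

Fact gl_inv_counit : counit H (gl_inv g) = 1.
Proof.
by rewrite -[LHS]mul1r -{1}(gl_counit g) -rmorphM gl_mulV rmorph1.
Qed.

Definition gl_inverse : groupLike H := GroupLike gl_inv_comul gl_inv_counit.

End GroupLike.

Section AutInverse.
Variables (k : fieldType) (H : hopfAlg k) (be : hopfAut H).

Fact aut_inv_linear : linear (aut_inv be).
Proof. by apply: can2_linear; [apply: aut_mapK | apply: aut_invK]. Qed.

HB.instance Definition _ :=
  GRing.isLinear.Build k H H *:%R (aut_inv be) aut_inv_linear.

Fact aut_inv_monoid_morphism : monoid_morphism (aut_inv be).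
Proof.
split=> [|x y]; apply: (can_inj (aut_mapK be)).
  by rewrite aut_invK rmorph1.
by rewrite rmorphM /= !aut_invK.
Qed.

HB.instance Definition _ :=
  GRing.isMonoidMorphism.Build H H (aut_inv be) aut_inv_monoid_morphism.

(** As [be] is a coalgebra map, evaluating [f] on a leg of [h] is evaluating [f \o aut_inv be] on
    the same leg of [be h]. This produces the be^-1 inside f1 in the formula for F. *)
Lemma aut_twl (f : {scalar H}) h : be (twl f h) = twl (f \o aut_inv be) (be h).
Proof.
rewrite [RHS]/twl aut_comul tsum_map; last bilin.
rewrite (linear_tsum (L := be)); last bilin.
by apply: eq_tsum => a b; rewrite linearZ /= aut_mapK.
Qed.

Lemma aut_twr (f : {scalar H}) h : be (twr f h) = twr (f \o aut_inv be) (be h).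
Proof.
rewrite [RHS]/twr aut_comul tsum_map; last bilin.
rewrite (linear_tsum (L := be)); last bilin.
by apply: eq_tsum => a b; rewrite linearZ /= aut_mapK.
Qed.

End AutInverse.

(** * Twists of the structure maps *)

Section Twist.
Variable k : fieldType.

(** What [th] and [p] must satisfy to carry the left-left condition for (al, be) to the one for
    (al', be'). The source pair is arbitrary rather than (id, id), so that the inverse of a twist is
    again a twist. *)
Record left_twist (H : hopfAlg k) (al be al' be' : hopfAut H)
    (th : H -> H) (p : groupLike H) : Prop := LeftTwist {
  ltw_linear : linear th;
  ltw1 : th 1 = 1;
  ltwM : {morph th : x y / x * y};
  ltw_be : forall h,
    \tsum_(h1, h2 <- comul H h) th h1 ⊗ be' h2
    = \tsum_(h1, h2 <- comul H (th h)) h1 ⊗ be h2;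
  ltw_al : forall h,
    \tsum_(h1, h2 <- comul H h) (al' h1 * gl_val p) ⊗ th h2
    = \tsum_(h1, h2 <- comul H (th h)) (gl_val p * al h1) ⊗ h2
}.

Record right_twist (H : hopfAlg k) (ga de ga' de' : hopfAut H)
    (ph : H -> H) (q : groupLike H) : Prop := RightTwist {
  rtw_linear : linear ph;
  rtw1 : ph 1 = 1;
  rtwM : {morph ph : x y / x * y};
  rtw_ga : forall h,
    \tsum_(h1, h2 <- comul H h) ga' h1 ⊗ ph h2
    = \tsum_(h1, h2 <- comul H (ph h)) ga h1 ⊗ h2;
  rtw_de : forall h,
    \tsum_(h1, h2 <- comul H h) ph h1 ⊗ (gl_val q * de' h2)
    = \tsum_(h1, h2 <- comul H (ph h)) h1 ⊗ (de h2 * gl_val q)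
}.

Section TwistInverse.
Variables (H : hopfAlg k) (a b a' b' : hopfAut H).
Variables (th th' : H -> H) (p : groupLike H).
Hypotheses (thK : cancel th th') (th'K : cancel th' th).

Let inv_linear : linear th -> linear th'.
Proof. by move=> thl c x y; apply: (can_inj thK); rewrite thl !th'K. Qed.

Let inv1 : th 1 = 1 -> th' 1 = 1.
Proof. by move=> th1; rewrite -[in LHS]th1 thK. Qed.

Let invM : {morph th : x y / x * y} -> {morph th' : x y / x * y}.
Proof. by move=> thM x y; apply: (can_inj thK); rewrite thM !th'K. Qed.

Lemma left_twist_inv :
  left_twist a b a' b' th p -> left_twist a' b' a b th' (gl_inverse p).
Proof.
case=> thl th1 thM thb tha; have th'l := inv_linear thl.
(* Every [h] is [th x], so both coproduct identities follow from those of the given twist at [x]. *)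
split=> [|||h|h]; [exact: th'l | exact: inv1 | exact: invM | |];
  rewrite -[h]th'K thK; set x := th' h.
  symmetry; have := thb x.
  move/(tsum_transfer (E := fun u v => th' u ⊗ v)) => <-; last by bilin.
  by apply: eq_tsum => u v; rewrite thK.
symmetry; have := tha x.
(* Multiplying by p^-1 on both sides turns a'(h1) p into p^-1 a'(h1), and p a(h1) into a(h1)
   p^-1. *)
move/(tsum_transfer (E := fun u v => (gl_inv p * u * gl_inv p) ⊗ th' v)).
move=> e; transitivity (\tsum_(h1, h2 <- comul H x)
    (gl_inv p * (a' h1 * gl_val p) * gl_inv p) ⊗ th' (th h2)).
  by apply: eq_tsum => u v; rewrite thK -!mulrA gl_mulV mulr1.
rewrite e; last bilin.
by apply: eq_tsum => u v; rewrite !mulrA gl_mulVl mul1r.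
Qed.

Lemma right_twist_inv :
  right_twist a b a' b' th p -> right_twist a' b' a b th' (gl_inverse p).
Proof.
case=> thl th1 thM tha thb; have th'l := inv_linear thl.
split=> [|||h|h]; [exact: th'l | exact: inv1 | exact: invM | |];
  rewrite -[h]th'K thK; set x := th' h.
  symmetry; have := tha x.
  move/(tsum_transfer (E := fun u v => u ⊗ th' v)) => e.
  transitivity (\tsum_(h1, h2 <- comul H x) a' h1 ⊗ th' (th h2)).
    by apply: eq_tsum => u v; rewrite thK.
  by rewrite e//; bilin.
symmetry; have := thb x.
move/(tsum_transfer (E := fun u v => th' u ⊗ (gl_inv p * v * gl_inv p))).
move=> e; transitivity (\tsum_(h1, h2 <- comul H x)
    th' (th h1) ⊗ (gl_inv p * (gl_val p * b' h2) * gl_inv p)).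
  by apply: eq_tsum => u v; rewrite thK !mulrA gl_mulVl mul1r.
rewrite e; last bilin.
by apply: eq_tsum => u v; rewrite -!mulrA gl_mulV mulr1.
Qed.

End TwistInverse.

Section LRTwist.
Variables (H1 H2 : hopfAlg k).
Variables (th : H1 -> H1) (p : groupLike H1) (ph : H2 -> H2) (q : groupLike H2).

(** The common shape of F and G; one proof of the axioms then serves both. *)
Definition LRtwist (M : lmodType k) (s : LRstr H1 H2 M) : LRstr H1 H2 M :=
  {| lact := fun h m => lact s (th h) m;
     lcoact := fun m => \tsum_(x, m0 <- lcoact s m) (gl_val p * x) ⊗ m0;
     ract := fun m h => ract s m (ph h);
     rcoact := fun m => \tsum_(m0, x <- rcoact s m) m0 ⊗ (x * gl_val q) |}.

Lemma LRtwist_mor (M N : lmodType k) (s : LRstr H1 H2 M) (t : LRstr H1 H2 N)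
    (f : M -> N) :
  is_LR_mor s t f -> is_LR_mor (LRtwist s) (LRtwist t) f.
Proof.
case=> fl fla fra flc frc; split=> //= m.
- by rewrite flc !tsum_map//; bilin.
- by rewrite frc !tsum_map//; bilin.
Qed.

Variables (al be al' be' : hopfAut H1) (ga de ga' de' : hopfAut H2).
Hypotheses (ltw : left_twist al be al' be' th p)
  (rtw : right_twist ga de ga' de' ph q).

(** The module axioms persist because [th] and [ph] are algebra maps, the comodule axioms because
    [p] and [q] are group-like, and the conditions relating left to right because the two twists
    affect separate factors. The twist identities enter in the left-left and right-right
    conditions. *)
Lemma is_LR_twist (M : lmodType k) (s : LRstr H1 H2 M) :
  is_LR al be ga de s -> is_LR al' be' ga' de' (LRtwist s).
Proof.
case: ltw rtw => [thl th1 thM thb tha] [phl ph1 phM phg phd].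
case=> [[bl l1 lM] [br r1 rM] lr [cl cA c1] [dl dA d1] cd ll lright rr rl].
split=> /=.
- split=> [|m|x y m]; [bilin | by rewrite th1 | by rewrite thM].
- split=> [|m|m x y]; [bilin | by rewrite ph1 | by rewrite phM].
- by move=> h m h'; apply: lr.
- split=> [|m|m]; first bilin.
  (* [E] multiplies both [H1] legs of the old iterated coaction by [p]. Iterating the new coaction
     gives this directly; the other side gives it through Delta(p x) = (p ⊗ p) Delta(x). *)
  + pose E x t : (H1 ⊗ (H1 ⊗ M))%type := \tsum_(y, m0 <- t)
      (gl_val p * x : H1) ⊗ ((gl_val p * y : H1) ⊗ (m0 : M)).
    have bE : is_bilinear E by rewrite /E; bilin.
    rewrite tsum_map; last bilin.
    rewrite [RHS]tsum_map; last bilin.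
    transitivity (\tsum_(x, m0 <- lcoact s m) E x (lcoact s m0)).
      rewrite -(tsum_map (fun x _ => x) (fun _ m0 => lcoact s m0)) // -cA.
      rewrite tsum_tsum//; apply: eq_tsum => x n; rewrite tsum_map//.
      rewrite comulM gl_comul tsum_tens ?tsum_map; try bilin.
      by apply: eq_tsum => u v; rewrite /E tsum_tens//; bilin.
    apply: eq_tsum => x n.
    by rewrite [RHS](linear_tsum (L := tens _)); [|bilin].
  + rewrite tsum_map; last bilin.
    rewrite -[RHS]c1; apply: eq_tsum => x n.
    by rewrite rmorphM /= gl_counit mul1r.
- split=> [|m|m]; first bilin.
  + pose E n t : (M ⊗ (H2 ⊗ H2))%type := \tsum_(y, x <- t)
      (n : M) ⊗ ((y * gl_val q : H2) ⊗ (x * gl_val q : H2)).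
    have bE : is_bilinear E by rewrite /E; bilin.
    rewrite tsum_map; last bilin.
    rewrite [RHS]tsum_map; last bilin.
    transitivity (\tsum_(n, x <- rcoact s m) E n (comul H2 x)).
      rewrite -(tsum_map (fun n _ => n) (fun _ x => comul H2 x)) // -dA.
      rewrite tsum_tsum//; apply: eq_tsum => n x; rewrite !tsum_map; try bilin.
      by apply: eq_tsum => u v; rewrite /E tsum_tens//; bilin.
    apply: eq_tsum => n x; rewrite [LHS]/E comulM gl_comul.
    rewrite [RHS](linear_tsum (L := tens _)); last bilin.
    by apply: eq_tsum => u v; rewrite tsum_tens//; bilin.
  + rewrite tsum_map; last bilin.
    rewrite -[RHS]d1; apply: eq_tsum => n x.
    by rewrite rmorphM /= gl_counit mulr1.
- move=> m.
  (* Both orders of the new coactions amount to [E] applied to the old ones: [p] on the outer left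
     leg, [q] on the outer right leg. *)
  pose E x t : (H1 ⊗ (M ⊗ H2))%type := \tsum_(n, y <- t)
    (gl_val p * x : H1) ⊗ ((n : M) ⊗ (y * gl_val q : H2)).
  have bE : is_bilinear E by rewrite /E; bilin.
  rewrite tsum_map; last bilin.
  rewrite [RHS]tsum_map; last bilin.
  transitivity (\tsum_(x, n <- lcoact s m) E x (rcoact s n)).
    by apply: eq_tsum => x n; rewrite (linear_tsum (L := tens _)); [|bilin].
  rewrite -(tsum_map (fun x _ => x) (fun _ n => rcoact s n))// cd.
  rewrite tsum_tsum//; apply: eq_tsum => n y; rewrite !tsum_map; try bilin.
  by apply: eq_tsum => u v; rewrite /E tsum_tens//; bilin.
- move=> h m.
  (* [E] and [E'] express the two sides as bilinear functions of the legs of [h]. The twist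
     identities replace these by the legs of [th h], and each side becomes [T], left multiplication
     by [p], of the old condition at [th h]. *)
  pose E x y : (H1 ⊗ M)%type := \tsum_(z, n <- lcoact s m) (x * z) ⊗ lact s y n.
  have bE : is_bilinear E by rewrite /E; bilin.
  pose E' x y : (H1 ⊗ M)%type :=
    \tsum_(z, n <- lcoact s (lact s x m)) (gl_val p * z * y) ⊗ n.
  have bE' : is_bilinear E' by rewrite /E'; bilin.
  pose T := fun (x : H1) (n : M) => (gl_val p * x) ⊗ n.
  have bT : is_bilinear T by rewrite /T; bilin.
  transitivity (\tsum_(h1, h2 <- comul H1 h) E (al' h1 * gl_val p) (th h2)).
    apply: eq_tsum => u v; rewrite tsum_map; last bilin.
    by apply: eq_tsum => x n; rewrite mulrA.
  transitivity (\tsum_(h1, h2 <- comul H1 h) E' (th h1) (be' h2)); last first.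
    by apply: eq_tsum => u v; rewrite tsum_map; last bilin.
  rewrite (tsum_transfer bE (tha h)) (tsum_transfer bE' (thb h)).
  transitivity (tsum T (\tsum_(h1, h2 <- comul H1 (th h))
    \tsum_(x, n <- lcoact s m) (al h1 * x) ⊗ lact s h2 n)).
    rewrite tsum_tsum//; apply: eq_tsum => u v; rewrite tsum_map//.
    by apply: eq_tsum => x n; rewrite /T !mulrA.
  rewrite ll tsum_tsum//; apply: eq_tsum => u v; rewrite tsum_map//.
  by apply: eq_tsum => x n; rewrite /T !mulrA.
- move=> h m; rewrite lright !tsum_map//; bilin.
- move=> m h.
  (* The mirror argument: [T] is right multiplication by [q], applied to the old condition at
     [ph h]. *)
  pose E x y : (M ⊗ H2)%type := \tsum_(n, z <- rcoact s m) ract s n x ⊗ (z * y).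
  have bE : is_bilinear E by rewrite /E; bilin.
  pose E' x y : (M ⊗ H2)%type :=
    \tsum_(n, z <- rcoact s (ract s m y)) n ⊗ (x * (z * gl_val q)).
  have bE' : is_bilinear E' by rewrite /E'; bilin.
  pose T := fun (n : M) (x : H2) => n ⊗ (x * gl_val q).
  have bT : is_bilinear T by rewrite /T; bilin.
  transitivity (\tsum_(h1, h2 <- comul H2 h) E (ph h1) (gl_val q * de' h2)).
    apply: eq_tsum => u v; rewrite tsum_map; last bilin.
    by apply: eq_tsum => x n; rewrite mulrA.
  transitivity (\tsum_(h1, h2 <- comul H2 h) E' (ga' h1) (ph h2)); last first.
    by apply: eq_tsum => u v; rewrite tsum_map; last bilin.
  rewrite (tsum_transfer bE (phd h)) (tsum_transfer bE' (phg h)).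
  transitivity (tsum T (\tsum_(h1, h2 <- comul H2 (ph h))
    \tsum_(n, x <- rcoact s m) ract s n h1 ⊗ (x * de h2))).
    rewrite tsum_tsum//; apply: eq_tsum => u v; rewrite tsum_map//.
    by apply: eq_tsum => x n; rewrite /T !mulrA.
  rewrite rr tsum_tsum//; apply: eq_tsum => u v; rewrite tsum_map//.
  by apply: eq_tsum => x n; rewrite /T !mulrA.
- move=> m h; rewrite rl !tsum_map//; bilin.
Qed.

End LRTwist.

(** The outer [th] is applied to [h] first, whence [cancel th th']; [p] multiplies on the left and
    [q] on the right, whence the opposite orders of the two products. *)
Lemma LRtwistK (H1 H2 : hopfAlg k) (th th' : H1 -> H1) (p p' : groupLike H1)
    (ph ph' : H2 -> H2) (q q' : groupLike H2)
    (M : lmodType k) (s : LRstr H1 H2 M) :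
  cancel th th' -> cancel ph ph' ->
  gl_val p * gl_val p' = 1 -> gl_val q' * gl_val q = 1 ->
  LRtwist th p ph q (LRtwist th' p' ph' q' s) = s.
Proof.
case: s => la lc ra rc thK phK pK qK; rewrite /LRtwist; congr LRStr => /=.
- by apply/funext => h; rewrite thK.
- apply/funext => m; rewrite tsum_map; last bilin.
  by rewrite -[RHS]tsum_id; apply: eq_tsum => x n; rewrite mulrA pK mul1r.
- by apply/funext => m; apply/funext => h; rewrite phK.
- apply/funext => m; rewrite tsum_map; last bilin.
  by rewrite -[RHS]tsum_id; apply: eq_tsum => n x; rewrite -mulrA qK mulr1.
Qed.

End Twist.

(** * From the involution condition to twists *)

Section InvolutionTwists.
Variables (k : fieldType) (H : hopfAlg k).

(** The involution conditions have this shape, with [L] an automorphism followed by conjugation by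
    the group-like element. *)
Lemma tsum_twl_twr_linear (V : lmodType k) (L : H -> V)
    (phi psi : {scalar H}) h :
  linear L ->
  \tsum_(h1, t <- comul H h) \tsum_(h2, h3 <- comul H t)
    (phi h1 * psi h3) *: L h2 = L (twl phi (twr psi h)).
Proof.
move=> lL; rewrite /twl comul_twr tsum_map; last bilin.
rewrite (linear_tsum (L := L))//; apply: eq_tsum => a b.
rewrite /twr (linear_tsum (L := fun x => L (phi a *: x))); last first.
  by move=> c x y; rewrite scalerDr scalerA mulrC -scalerA lL.
by apply: eq_tsum => c d; rewrite scalerA (GRing.scalable_linear lL).
Qed.

Variables (f : {lrmorphism H -> k | *%R}) (g : groupLike H).

Lemma left_involution_twist (al be : hopfAut H) :
  (forall h : H,
     al h = \tsum_(h1, t <- comul H h) \tsum_(h2, h3 <- comul H t)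
       (f h1 * f (antipode H h3)) *: (gl_val g * be h2 * gl_inv g)) ->
  left_twist (hopf_id H) (hopf_id H) al be (be \o twl f) g.
Proof.
move=> alE.
have comul_th h : comul H (be (twl f h))
    = \tsum_(h1, h2 <- comul H h) be (twl f h1) ⊗ be h2.
  by rewrite aut_comul comul_twl tsum_map//; bilin.
(* Evaluating the involution condition at [twr f h] cancels its twist by [f \o antipode H]. *)
have al_twr h : al (twr f h) = gl_val g * be (twl f h) * gl_inv g.
  pose L x := gl_val g * be x * gl_inv g.
  have lL : linear L by rewrite /L; bilin.
  rewrite alE (tsum_twl_twr_linear f (f \o antipode H))//.
  by rewrite conv_unit_twr//; apply: conv_unit_antipodel.
split=> /= [||x y|h|h].
- bilin.
- by rewrite twl1 rmorph1.
- by rewrite /= twlM rmorphM.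
- by rewrite tsum_id comul_th.
- rewrite comul_th tsum_map; last bilin.
  (* Moves the twist off the second leg onto the argument of [al], where [al_twr] applies. *)
  have := tsum_twl_twr f h.
  move/(tsum_transfer (E := fun u v => (al u * gl_val g) ⊗ be v)) => -> /=.
    apply: eq_tsum => u v.
    by rewrite al_twr -!mulrA gl_mulVl mulr1.
  bilin.
Qed.

Lemma right_involution_twist (ga de : hopfAut H) :
  (forall h : H,
     de h = \tsum_(h1, t <- comul H h) \tsum_(h2, h3 <- comul H t)
       (f (antipode H h1) * f h3) *: (gl_inv g * ga h2 * gl_val g)) ->
  right_twist (hopf_id H) (hopf_id H) ga de (ga \o twr f) g.
Proof.
move=> deE.
have comul_ph h : comul H (ga (twr f h))
    = \tsum_(h1, h2 <- comul H h) ga h1 ⊗ ga (twr f h2).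
  by rewrite aut_comul comul_twr tsum_map//; bilin.
have de_twl h : de (twl f h) = gl_inv g * ga (twr f h) * gl_val g.
  pose L x := gl_inv g * ga x * gl_val g.
  have lL : linear L by rewrite /L; bilin.
  (* Commuting the hit actions brings the two left ones together, where they cancel. *)
  rewrite deE (tsum_twl_twr_linear (f \o antipode H) f)// twl_twr.
  by rewrite conv_unit_twl//; apply: conv_unit_antipoder.
split=> /= [||x y|h|h].
- bilin.
- by rewrite twr1 rmorph1.
- by rewrite /= twrM rmorphM.
- by rewrite tsum_id comul_ph.
- rewrite comul_ph tsum_map; last bilin.
  have /esym := tsum_twl_twr f h.
  move/(tsum_transfer (E := fun u v => ga u ⊗ (gl_val g * de v))) => /= e.
  rewrite e; last bilin.
  by apply: eq_tsum => u v; rewrite de_twl !mulrA gl_mulV mul1r.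
Qed.

Variable be : hopfAut H.

(** The character by which [f] is replaced when [be] is moved past [twl f] or [twr f]; its
    convolution inverse [fb \o antipode H] therefore gives the inverse twists. *)
Let fb : {lrmorphism H -> k | *%R} := f \o aut_inv be.

Lemma left_twist_mapK :
  cancel (be \o twl f) (aut_inv be \o twl (fb \o antipode H)).
Proof.
move=> h; rewrite /= aut_twl conv_unit_twl ?aut_mapK//.
exact: (conv_unit_antipoder fb).
Qed.

Lemma left_twist_invK :
  cancel (aut_inv be \o twl (fb \o antipode H)) (be \o twl f).
Proof.
move=> h; rewrite /= aut_twl aut_invK conv_unit_twl//.
exact: (conv_unit_antipodel fb).
Qed.

Lemma right_twist_mapK :
  cancel (be \o twr f) (aut_inv be \o twr (fb \o antipode H)).
Proof.
move=> h; rewrite /= aut_twr conv_unit_twr ?aut_mapK//.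
exact: (conv_unit_antipodel fb).
Qed.

Lemma right_twist_invK :
  cancel (aut_inv be \o twr (fb \o antipode H)) (be \o twr f).
Proof.
move=> h; rewrite /= aut_twr aut_invK conv_unit_twr//.
exact: (conv_unit_antipoder fb).
Qed.

End InvolutionTwists.

(** * Strict equality of functors *)

Section Functors.

(** Morphisms are compared after transport along [e]. Once extensionality has identified the object
    maps, proof irrelevance turns each [e x] into [erefl] and the transports vanish. *)
Lemma functor_eq (C D : category) (F G : functor C D)
    (e : forall x, F x = G x) :
  (forall (x y : C) (u : Defs.hom x y),
     ecast z (Defs.hom z (G y)) (e x)
       (ecast z (Defs.hom (F x) z) (e y) (fmap F u))
     = fmap G u) ->
  F = G.
Proof.
case: F G e => F Fm F1 FD [G Gm G1 GD] /= e.
have E : F = G by apply/funext.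
case: _ / E in Gm G1 GD e * => emap.
have E : Fm = Gm.
  apply: functional_extensionality_dep => x.
  apply: functional_extensionality_dep => y.
  apply/funext => u; rewrite -emap.
  by rewrite (Prop_irrelevance (e x) erefl) (Prop_irrelevance (e y) erefl).
case: _ / E in G1 GD emap *.
by congr Functor; apply: Prop_irrelevance.
Qed.

Variables (k : fieldType) (H1 H2 : hopfAlg k).
Variables (al be : hopfAut H1) (ga de : hopfAut H2).

Lemma LROb_eq (M : lmodType k) (s t : LRstr H1 H2 M)
    (sP : is_LR al be ga de s) (tP : is_LR al be ga de t) :
  s = t -> LROb sP = LROb tP.
Proof.
by move=> E; case: _ / E in tP *; congr LROb; apply: Prop_irrelevance.
Qed.

(** Transport is the identity on underlying functions because both objects have literally the same
    space. The equalities of structures are separate premises since they, unlike [es] and [et], can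
    be eliminated directly. *)
Lemma LRhom_ecast (M N : lmodType k) (s s' : LRstr H1 H2 M)
    (t t' : LRstr H1 H2 N)
    (sP : is_LR al be ga de s) (s'P : is_LR al be ga de s')
    (tP : is_LR al be ga de t) (t'P : is_LR al be ga de t')
    (es : LROb sP = LROb s'P) (et : LROb tP = LROb t'P)
    (u : LRhom (LROb sP) (LROb tP)) (v : LRhom (LROb s'P) (LROb t'P)) :
  s = s' -> t = t' -> LR_fun u =1 LR_fun v ->
  ecast z (LRhom z (LROb t'P)) es (ecast z (LRhom (LROb sP) z) et u) = v.
Proof.
move=> E E'; case: _ / E in s'P es v *; case: _ / E' in t'P et v *.
case: _ / (Prop_irrelevance sP s'P) in es v *.
case: _ / (Prop_irrelevance tP t'P) in et v *.
rewrite (Prop_irrelevance es erefl) (Prop_irrelevance et erefl) /=.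
by move=> uv; apply: LRhom_eq => x; apply: uv.
Qed.

Variables (al' be' : hopfAut H1) (ga' de' : hopfAut H2).

(** Cancellation is asked only on structures satisfying the axioms, because the formulas for F and G
    are identified with twists through bilinearity of the actions. *)
Lemma LR_change_cancel
    (Phi Psi : forall M : lmodType k, LRstr H1 H2 M -> LRstr H1 H2 M)
    (PhiO : preserves_LR al be al' be' ga de ga' de' Phi)
    (PhiM : preserves_LR_mor al be ga de Phi)
    (PsiO : preserves_LR al' be' al be ga' de' ga de Psi)
    (PsiM : preserves_LR_mor al' be' ga' de' Psi) :
  (forall (M : lmodType k) (s : LRstr H1 H2 M),
     is_LR al be ga de s -> Psi M (Phi M s) = s) ->
  functor_comp (LR_change PsiO PsiM) (LR_change PhiO PhiM)
  = functor_id (LR_category al be ga de).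
Proof.
move=> PhiK.
have e (M : LR_category al be ga de) :
    functor_comp (LR_change PsiO PsiM) (LR_change PhiO PhiM) M
    = functor_id (LR_category al be ga de) M.
  by case: M => M s sP; apply: LROb_eq; apply: PhiK.
apply: (functor_eq (e := e)) => -[M s sP] [N t tP] u.
by apply: LRhom_ecast => //; apply: PhiK.
Qed.

End Functors.

(** * F and G as mutually inverse twists *)

Section InvolutionFunctors.
Variables (k : fieldType) (H1 H2 : hopfAlg k).
Variables (al be : hopfAut H1) (ga de : hopfAut H2).
Variables (f1 : {lrmorphism H1 -> k | *%R}) (g1 : groupLike H1).
Variables (f2 : {lrmorphism H2 -> k | *%R}) (g2 : groupLike H2).

Local Notation th := (be \o twl f1).
Local Notation ph := (ga \o twr f2).
Local Notation th' := (aut_inv be \o twl ((f1 \o aut_inv be) \o antipode H1)).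
Local Notation ph' := (aut_inv ga \o twr ((f2 \o aut_inv ga) \o antipode H2)).

(** Bilinearity of the actions, taken from the axioms on [s], moves the scalars f1(h1) and f2(h2)
    inside, and the sums collapse to [twl f1] and [twr f2]. *)
Lemma G_strE (a b : hopfAut H1) (c d : hopfAut H2) (M : lmodType k)
    (s : LRstr H1 H2 M) :
  is_LR a b c d s ->
  G_str be ga f1 g1 f2 g2 s = LRtwist th g1 ph g2 s.
Proof.
case=> [[bl _ _] [br _ _] _ _ _ _ _ _ _ _].
rewrite /G_str /LRtwist; congr LRStr.
  apply/funext => h; apply/funext => m /=.
  rewrite [RHS](linear_tsum (L := fun x => lact s (be x) m)); last bilin.
  by apply: eq_tsum => x y; rewrite linearZ /= bilinZl.
apply/funext => m; apply/funext => h /=.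
rewrite [RHS](linear_tsum (L := fun x => ract s m (ga x))); last bilin.
by apply: eq_tsum => x y; rewrite linearZ /= bilinZr.
Qed.

Lemma F_strE (a b : hopfAut H1) (c d : hopfAut H2) (M : lmodType k)
    (s : LRstr H1 H2 M) :
  is_LR a b c d s ->
  F_str be ga f1 g1 f2 g2 s
  = LRtwist th' (gl_inverse g1) ph' (gl_inverse g2) s.
Proof.
case=> [[bl _ _] [br _ _] _ _ _ _ _ _ _ _].
rewrite /F_str /LRtwist; congr LRStr.
  apply/funext => h; apply/funext => m /=.
  rewrite [RHS](linear_tsum (L := fun x => lact s (aut_inv be x) m)).
    by apply: eq_tsum => x y; rewrite linearZ /= bilinZl.
  bilin.
apply/funext => m; apply/funext => h /=.
rewrite [RHS](linear_tsum (L := fun x => ract s m (aut_inv ga x))); last bilin.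
by apply: eq_tsum => x y; rewrite linearZ /= bilinZr.
Qed.

Hypothesis inv : quadruple_in_involution al be ga de f1 g1 f2 g2.

Let ltw := left_involution_twist inv.1.
Let rtw := right_involution_twist inv.2.

Lemma G_str_LR :
  preserves_LR (hopf_id H1) (hopf_id H1) al be (hopf_id H2) (hopf_id H2) ga de
    (G_str be ga f1 g1 f2 g2).
Proof. by move=> M s sP; rewrite (G_strE sP); apply: is_LR_twist sP. Qed.

Lemma F_str_LR :
  preserves_LR al be (hopf_id H1) (hopf_id H1) ga de (hopf_id H2) (hopf_id H2)
    (F_str be ga f1 g1 f2 g2).
Proof.
move=> M s sP; rewrite (F_strE sP); apply: is_LR_twist sP.
  exact: left_twist_inv (left_twist_mapK f1 be) (left_twist_invK f1 be) ltw.
exact: right_twist_inv (right_twist_mapK f2 ga) (right_twist_invK f2 ga) rtw.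
Qed.

Lemma G_str_LR_mor :
  preserves_LR_mor (hopf_id H1) (hopf_id H1) (hopf_id H2) (hopf_id H2)
    (G_str be ga f1 g1 f2 g2).
Proof.
move=> M N s t u sP tP uP.
by rewrite (G_strE sP) (G_strE tP); apply: LRtwist_mor.
Qed.

Lemma F_str_LR_mor : preserves_LR_mor al be ga de (F_str be ga f1 g1 f2 g2).
Proof.
move=> M N s t u sP tP uP.
by rewrite (F_strE sP) (F_strE tP); apply: LRtwist_mor.
Qed.

Lemma F_strK (M : lmodType k) (s : LRstr H1 H2 M) :
  is_LR al be ga de s ->
  G_str be ga f1 g1 f2 g2 (F_str be ga f1 g1 f2 g2 s) = s.
Proof.
move=> sP; rewrite (G_strE (F_str_LR sP)) (F_strE sP).
apply: LRtwistK; [exact: left_twist_mapK | exact: right_twist_mapK | |].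
  exact: gl_mulV.
exact: gl_mulVl.
Qed.

Lemma G_strK (M : lmodType k) (s : LRstr H1 H2 M) :
  is_LR (hopf_id H1) (hopf_id H1) (hopf_id H2) (hopf_id H2) s ->
  F_str be ga f1 g1 f2 g2 (G_str be ga f1 g1 f2 g2 s) = s.
Proof.
move=> sP; rewrite (F_strE (G_str_LR sP)) (G_strE sP).
apply: LRtwistK; [exact: left_twist_invK | exact: right_twist_invK | |].
  exact: gl_mulVl.
exact: gl_mulV.
Qed.

End InvolutionFunctors.

Theorem theorem4p1 (k : fieldType) (H1 H2 : hopfAlg k)
    (al be : hopfAut H1) (ga de : hopfAut H2)
    (f1 : {lrmorphism H1 -> k | *%R}) (g1 : groupLike H1)
    (f2 : {lrmorphism H2 -> k | *%R}) (g2 : groupLike H2) :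
  quadruple_in_involution al be ga de f1 g1 f2 g2 ->
  isomorphic_categories (LR_category al be ga de) (LR_category_id H1 H2) /\
  exists
    (FO : preserves_LR al be (hopf_id H1) (hopf_id H1)
            ga de (hopf_id H2) (hopf_id H2) (F_str be ga f1 g1 f2 g2))
    (FM : preserves_LR_mor al be ga de (F_str be ga f1 g1 f2 g2))
    (GO : preserves_LR (hopf_id H1) (hopf_id H1) al be
            (hopf_id H2) (hopf_id H2) ga de (G_str be ga f1 g1 f2 g2))
    (GM : preserves_LR_mor (hopf_id H1) (hopf_id H1)
            (hopf_id H2) (hopf_id H2) (G_str be ga f1 g1 f2 g2)),
    inverse_functors (LR_change FO FM) (LR_change GO GM).
Proof.
move=> inv.
pose F := LR_change (F_str_LR inv)
  (@F_str_LR_mor _ _ _ al be ga de f1 g1 f2 g2).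
pose G := LR_change (G_str_LR inv) (@G_str_LR_mor _ _ _ be ga f1 g1 f2 g2).
have FG : inverse_functors F G.
  split; first by apply: LR_change_cancel => M s; apply: (F_strK inv).
  by apply: LR_change_cancel => M s; apply: (G_strK inv).
split; first by exists F, G.
(* The four preservation proofs are recovered by unification with [F] and [G]. *)
by do 4 eexists; exact: FG.
Qed.
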